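(* Let $\Gamma$ be an extended Dynkin graph with vertex set $I$ and standard integral generalized Cartan matrix $C$, let $W$ be the associated affine Weyl group, and let $v\in\mathbb{R}^I$ be a configuration with $\delta\cdot v=0$ (the case in which the numbers game loops). Then for every $g\in W$ there is a finite sequence of legal moves of the numbers game taking $v$ to $g v$. In particular, from any configuration reached from $v$ by playing the numbers game, one can always return to the initial configuration $v$ by playing the numbers game.
   Context: $\Gamma$ is the Dynkin diagram of an affine Weyl group (types $\widetilde{A_n},\widetilde{B_n},\widetilde{C_n},\widetilde{D_n},\widetilde{E_6},\widetilde{E_7},\widetilde{E_8},\widetilde{F_4},\widetilde{G_2}$), with vertex set $I$ and standard integral generalized Cartan matrix $C=(c_{ij})_{i,j\in I}$ ($c_{ii}=2$, $c_{ij}\le 0$ for $i\neq j$, $c_{ij}=0$ iff $i,j$ are not adjacent). Configurations are vectors $v\in\mathbb{R}^I$ (entries are called amplitudes). For $i\in I$ let $f_i:\mathbb{R}^I\to\mathbb{R}^I$ be the linear map $f_i(v)_i=-v_i$, $f_i(v)_j=v_j-c_{ij}v_i$ if $j$ is adjacent to $i$, and $f_i(v)_j=v_j$ otherwise; the simple reflection $s_i$ of $W$ acts on $\mathbb{R}^I$ by $f_i$. A legal move of the numbers game (firing vertex $i$) is allowed from $v$ only if $v_i<0$, and replaces $v$ by $f_i(v)$. Let $\alpha^{(i)}$, $i\in I$, be the standard basis of $\mathbb{Z}^I$ (simple roots), with Cartan form $\langle\alpha^{(i)},\alpha^{(j)}\rangle=c_{ij}$; $W$ acts on $\mathbb{Z}^I$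 by $s_i\alpha=\alpha-\langle\alpha,\alpha^{(i)}\rangle\alpha^{(i)}$, and the roots $\Delta$ are the $W$-orbit of the simple roots. A vertex $i$ is extending if $\Gamma\setminus\{i\}$ is a Dynkin graph whose extended Dynkin graph is $\Gamma$ with $i$ as extending vertex. $\delta\in\mathbb{Z}_{\ge0}^I$ is the unique vector with $\delta_i=1$ at all extending vertices and $\langle\delta,\alpha\rangle=0$ for all $\alpha\in\Delta$; $\delta\cdot v=\sum_i\delta_iv_i$ is the usual dot product.
   Formalization: The vector δ is taken with ⟨α,δ⟩=0 for all roots (Cδ=0) instead of ⟨δ,α⟩=0; these differ when C is not symmetric, and the claim as written then fails (in type C~_2, δ=(1,1,1), v=(-1,1,0) goes to the terminal (1,0,0)). *)

(* Defs.v *)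
From HB Require Import structures.
From mathcomp Require Import all_boot all_order all_algebra.
From mathcomp Require Import reals.
Set Implicit Arguments. Unset Strict Implicit. Unset Printing Implicit Defensive.
Import Order.TTheory GRing.Theory Num.Theory.
Local Open Scope ring_scope.

Inductive affine_type :=
| TA of nat | TB of nat | TC of nat | TD of nat
| TE6 | TE7 | TE8 | TF4 | TG2.

Definition valid_type (t : affine_type) : bool :=
  match t with
  | TA n => (1 <= n)%N | TB n => (3 <= n)%N | TC n => (2 <= n)%N
  | TD n => (4 <= n)%N | _ => true
  end.

Definition nv (t : affine_type) : nat :=
  match t with
  | TA n | TB n | TC n | TD n => n.+1
  | TE6 => 7 | TE7 => 8 | TE8 => 9 | TF4 => 5 | TG2 => 3
  end.

Definition adj_chain (i j : nat) : bool := (i.+1 == j) || (j.+1 == i).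
Definition edge_in (s : seq (nat * nat)) (i j : nat) : bool :=
  ((i, j) \in s) || ((j, i) \in s).

(* Vertex labelling (vertex 0 is always an extending vertex):
   A~_n : cycle 0-1-...-n-0   (A~_1: double edge, c01 = c10 = -2)
   B~_n : 0-2, 1-2, chain 2-...-n, last bond n-1 => n with n short
   C~_n : chain 0-...-n, 0 and n long, 1..n-1 short
   D~_n : 0-2, 1-2, chain 2-...-(n-2), (n-1)-(n-2), n-(n-2)
   E~6  : chain 1-2-3-4-5, 3-6, 6-0
   E~7  : chain 0-1-2-3-4-5-6, 3-7
   E~8  : chain 0-1-...-7, 5-8
   F~4  : 0-1-2=>3-4 (0,1,2 long; 3,4 short)
   G~2  : 0-1=>2 (0,1 long; 2 short)
   Convention (Kac): c_ij = 2(a_i,a_j)/(a_i,a_i). *)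
Definition cm (t : affine_type) (i j : nat) : int :=
  if i == j then 2 else
  match t with
  | TA n =>
      if n == 1%N then -2 else
      if adj_chain i j || ((i == 0%N) && (j == n)) || ((j == 0%N) && (i == n))
      then -1 else 0
  | TB n =>
      if (i == n) && (j == n.-1) then -2 else
      if (((i == 0%N) || (i == 1%N)) && (j == 2%N))
         || (((j == 0%N) || (j == 1%N)) && (i == 2%N))
         || [&& (2 <= i)%N, (2 <= j)%N & adj_chain i j]
      then -1 else 0
  | TC n =>
      if ((i == 1%N) && (j == 0%N)) || ((i == n.-1) && (j == n)) then -2 else
      if adj_chain i j then -1 else 0
  | TD n =>
      if (((i == 0%N) || (i == 1%N)) && (j == 2%N))
         || (((j == 0%N) || (j == 1%N)) && (i == 2%N))
         || [&& (2 <= i)%N, (i <= n - 2)%N, (2 <= j)%N, (j <= n - 2)%N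
              & adj_chain i j]
         || (((i == n.-1) || (i == n)) && (j == n - 2)%N)
         || (((j == n.-1) || (j == n)) && (i == n - 2)%N)
      then -1 else 0
  | TE6 => if edge_in [:: (1,2); (2,3); (3,4); (4,5); (3,6); (6,0)]%N i j
           then -1 else 0
  | TE7 => if edge_in [:: (0,1); (1,2); (2,3); (3,4); (4,5); (5,6); (3,7)]%N i j
           then -1 else 0
  | TE8 => if edge_in [:: (0,1); (1,2); (2,3); (3,4); (4,5); (5,6); (6,7);
                          (5,8)]%N i j
           then -1 else 0
  | TF4 => if (i == 3%N) && (j == 2%N) then -2 else
           if edge_in [:: (0,1); (1,2); (2,3); (3,4)]%N i j then -1 else 0
  | TG2 => if (i == 2%N) && (j == 1%N) then -3 else
           if edge_in [:: (0,1); (1,2)]%N i j then -1 else 0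
  end.

Definition cartan (t : affine_type) (i j : 'I_(nv t)) : int := cm t i j.

Definition extending (t : affine_type) (i : 'I_(nv t)) : bool :=
  let k := nat_of_ord i in
  match t with
  | TA _ => true
  | TB _ => (k == 0%N) || (k == 1%N)
  | TC n => (k == 0%N) || (k == n)
  | TD n => [|| k == 0%N, k == 1%N, k == n.-1 | k == n]
  | TE6 => [|| k == 0%N, k == 1%N | k == 5%N]
  | TE7 => (k == 0%N) || (k == 6%N)
  | TE8 | TF4 | TG2 => k == 0%N
  end.

Section Game.
Variables (R : realType) (t : affine_type).
Local Notation I := 'I_(nv t).
Local Notation config := {ffun I -> R}.

Definition fire (i : I) (v : config) : config :=
  [ffun j => if j == i then - v i else v j - (cartan i j)%:~R * v i].

(* action of a word g = s_{i1} ... s_{ik} of W (rightmost acts first) *)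
Definition act (w : seq I) (v : config) : config := foldr fire v w.

Inductive legal_reach : config -> config -> Prop :=
| lr_refl (v : config) : legal_reach v v
| lr_step (v : config) (i : I) (w : config) : v i < 0 -> legal_reach (fire i v) w -> legal_reach v w.

Definition dotv (d : {ffun I -> int}) (v : config) : R :=
  \sum_(i : I) (d i)%:~R * v i.
End Game.

Section Roots.
Variable t : affine_type.
Local Notation I := 'I_(nv t).

Definition simple_root (i : I) : {ffun I -> int} := [ffun j => (j == i)%:Z].

Definition cform (x y : {ffun I -> int}) : int :=
  \sum_(i : I) \sum_(j : I) x i * cartan i j * y j.

Definition sref (i : I) (a : {ffun I -> int}) : {ffun I -> int} :=
  [ffun j => a j - cform a (simple_root i) * simple_root i j].

Inductive is_root : {ffun I -> int} -> Prop :=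
| root_simple i : is_root (simple_root i)
| root_refl i a : is_root a -> is_root (sref i a).

Definition is_delta (d : {ffun I -> int}) : Prop :=
  (forall i, 0 <= d i) /\ (forall i, extending i -> d i = 1) /\
  (forall a, is_root a -> cform a d = 0).
End Roots.

(* Main.v *)
(* A legal move at [i] leads from [u], with [u i < 0], to [fire i u], whose [i]-th amplitude is
   [- u i]. Giving this edge the weight [d i * `|u i|], the outflow minus the inflow at [u] is
   [- dotv d u = 0], so the weights form a circulation. The orbit of [v] is finite: amplitudes of
   its elements are the values at [v] of integer vectors (roots) of bounded norm for the Cartan
   form, which is positive semidefinite with radical spanned by [d], and [d] itself has value 0.
   In a finite circulation no edge enters a set closed under outgoing edges; hence the set of
   configurations reachable from [v] is closed under all [fire i], so it is the whole orbit. *)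
Require Import Defs.
From HB Require Import structures.
From mathcomp Require Import all_boot all_order all_algebra.
From mathcomp Require Import boolp reals zify ring lra.
Set Implicit Arguments. Unset Strict Implicit. Unset Printing Implicit Defensive.
Import Order.TTheory GRing.Theory Num.Theory.
Local Open Scope ring_scope.

(** * Signs and symmetrizability of the Cartan matrices *)

Lemma cartan_diag (t : affine_type) (i : 'I_(nv t)) : cartan i i = 2.
Proof. by rewrite /cartan /cm eqxx. Qed.

Lemma cartan_le0 (t : affine_type) (i j : 'I_(nv t)) : i != j -> cartan i j <= 0.
Proof.
rewrite -val_eqE /cartan /cm /=; move: (nat_of_ord i) (nat_of_ord j) => {}i {}j /negbTE->.
by case: t => [n|n|n|n|||||]; repeat case: ifP.
Qed.

(* Half the squared length of the simple root [i], in the scaling of Kac's convention. *)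
Definition half_norm (t : affine_type) (i : nat) : int :=
  match t with
  | TB n => if i == n then 1 else 2
  | TC n => if (i == 0%N) || (i == n) then 2 else 1
  | TF4 => if (i <= 2)%N then 2 else 1
  | TG2 => if i == 2%N then 1 else 3
  | _ => 1
  end.

Lemma half_norm_ge1 (t : affine_type) i : 1 <= half_norm t i.
Proof. by case: t => *; rewrite /half_norm //; case: ifP. Qed.

(** In Kac's convention both sides are the inner product of the simple roots [i] and [j]. *)
Lemma cartan_symmetrizable (t : affine_type) (i j : 'I_(nv t)) : valid_type t ->
  half_norm t i * cartan i j = half_norm t j * cartan j i.
Proof.
move=> Ht; rewrite /cartan; move: (nat_of_ord i) (nat_of_ord j) (ltn_ord i) (ltn_ord j) => {}i {}j it jt.
move: Ht it jt.
have [->//|ij] := eqVneq i j.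
case: t => [n|n|n|n|||||] /=; rewrite /cm /half_norm /adj_chain /edge_in /=;
  rewrite ?[j == i]eq_sym (negbTE ij) ?in_cons ?in_nil ?xpair_eqE.
- by move=> *; repeat case: ifP => //=; lia.
- by move=> *; repeat case: ifP => //=; lia.
- by move=> *; repeat case: ifP => //=; lia.
- by move=> *; repeat case: ifP => //=; lia.
all: move=> _.
all: by do 9?[case: i ij => [|i] ij //=]; do 9?[case: j ij => [|j] ij //=].
Qed.

(** * Firing as an involution, words and legal play *)

Lemma fireE (R : realType) (t : affine_type) (i : 'I_(nv t)) (v : {ffun 'I_(nv t) -> R}) j :
  fire i v j = v j - (cartan i j)%:~R * v i.
Proof.
rewrite ffunE; case: eqP => [->|//].
by rewrite cartan_diag; ring.
Qed.

Lemma fireK (R : realType) (t : affine_type) (i : 'I_(nv t)) : involutive (@fire R t i).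
Proof.
move=> v; apply/ffunP => j; rewrite !fireE cartan_diag; ring.
Qed.

Lemma act_revK (R : realType) (t : affine_type) (w : seq 'I_(nv t)) (v : {ffun 'I_(nv t) -> R}) :
  act (rev w) (act w v) = v.
Proof.
elim: w => [//|i w IH]; rewrite rev_cons -cats1 /act foldr_cat /= fireK.
exact: IH.
Qed.

Lemma legal_reach_act (R : realType) (t : affine_type) (v u : {ffun 'I_(nv t) -> R}) :
  legal_reach v u -> exists w, u = act w v.
Proof.
elim=> [{}v|{}v i {}u _ _ [w ->]]; first by exists [::].
by exists (rcons w i); rewrite /act foldr_rcons.
Qed.

Lemma legal_reach_rcons (R : realType) (t : affine_type) (v u : {ffun 'I_(nv t) -> R}) i :
  legal_reach v u -> u i < 0 -> legal_reach v (fire i u).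
Proof.
elim=> [{}v|{}v j {}u vj _ IH] ui; last exact: lr_step vj (IH ui).
exact: lr_step ui (lr_refl _).
Qed.

(** * Invariance of [dotv d] and the circulation argument *)

Lemma dotv_fire (R : realType) (t : affine_type) (d : {ffun 'I_(nv t) -> int}) i
    (v : {ffun 'I_(nv t) -> R}) :
  \sum_j cartan i j * d j = 0 -> dotv d (fire i v) = dotv d v.
Proof.
move=> di; rewrite /dotv.
transitivity (\sum_j ((d j)%:~R * v j - (cartan i j * d j)%:~R * v i)).
  by apply: eq_bigr => j _; rewrite fireE rmorphM /=; ring.
by rewrite sumrB -mulr_suml -rmorph_sum di /= mul0r subr0.
Qed.

Lemma closed_under_fire (R : realType) (t : affine_type) (d : {ffun 'I_(nv t) -> int})
    (orb : seq {ffun 'I_(nv t) -> R}) (b : pred {ffun 'I_(nv t) -> R}) :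
  (forall i, 0 < d i) -> uniq orb ->
  (forall i u, u \in orb -> fire i u \in orb) ->
  (forall u, u \in orb -> dotv d u = 0) ->
  (forall i u, b u -> u i < 0 -> b (fire i u)) ->
  forall i u, u \in orb -> b u -> b (fire i u).
Proof.
move=> dpos uorb forb dorb blegal.
(* An edge joining [u] and [fire i u] contributes the same amount from either end, and contributes
   zero unless [b] differs at its ends. *)
pose term (u : {ffun 'I_(nv t) -> R}) i : R :=
  (d i)%:~R * (((b u)%:R - (b (fire i u))%:R) * u i).
have fire_neg i (u : {ffun 'I_(nv t) -> R}) : fire i u i = - u i.
  by rewrite ffunE eqxx.
have term_ge0 u i : 0 <= term u i.
  have di : 0 <= (d i)%:~R :> R by rewrite ler0z ltW.
  apply: mulr_ge0 => //.
  have [ui|ui|->] := ltgtP (u i) 0; last by rewrite mulr0.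
  - have := blegal i u; rewrite ui => /(_ _ isT).
    by case: (b u); case: (b _) => H; rewrite ?mulr0n ?mulr1n; (try by have := H isT); lra.
  (* Here the legal move goes from [fire i u] back to [u], so [b (fire i u)] implies [b u]. *)
  - have := blegal i (fire i u); rewrite fire_neg oppr_lt0 fireK ui => /(_ _ isT).
    by case: (b u); case: (b _) => H; rewrite ?mulr0n ?mulr1n; (try by have := H isT); lra.
have reindex i : \sum_(u <- orb) (b (fire i u))%:R * u i = - \sum_(u <- orb) (b u)%:R * u i.
  have Eorb : perm_eq orb (map (fire i) orb).
    apply: uniq_perm => //; first by rewrite map_inj_uniq //; exact: inv_inj (fireK i).
    move=> u; apply/idP/mapP => [uo|[u' uo ->]]; last exact: forb.
    by exists (fire i u); rewrite ?fireK ?forb.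
  rewrite [LHS](perm_big _ Eorb) big_map -sumrN; apply: eq_bigr => u _.
  by rewrite fireK fire_neg mulrN.
have tot : \sum_(u <- orb) \sum_i term u i = 0.
  rewrite exchange_big /=.
  (* The sign change in [reindex] turns the total into twice the sum of [dotv d u] over the [u] in
     [orb] with [b u]. *)
  transitivity (\sum_i \sum_(u <- orb) 2 * ((b u)%:R * ((d i)%:~R * u i))).
    apply: eq_bigr => i _; rewrite /term -!mulr_sumr.
    transitivity ((d i)%:~R * (\sum_(u <- orb) (b u)%:R * u i - \sum_(u <- orb) (b (fire i u))%:R * u i)).
      by congr (_ * _); rewrite -sumrB; apply: eq_bigr => u _; rewrite mulrBl.
    rewrite reindex opprK -mulr2n mulrnAr -mulr_natl; congr (_ * _).
    by rewrite mulr_sumr; apply: eq_bigr => u _; rewrite mulrCA.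
  rewrite exchange_big /= big_seq big1 // => u /dorb du.
  by rewrite -!mulr_sumr -/(dotv d u) du !mulr0.
move=> i u uo bu.
have [ui|ui|ui] := ltgtP (u i) 0.
- exact: blegal.
(* Nonnegative terms with sum zero all vanish; as [b u] holds and [u i > 0], this forces
   [b (fire i u)]. *)
- have : \sum_(u <- orb) \sum_i term u i == 0 by apply/eqP.
  rewrite psumr_eq0 => [/allP/(_ u uo)|? _]; last exact: sumr_ge0.
  rewrite /= psumr_eq0 // => /allP/(_ i); rewrite mem_index_enum => /(_ isT).
  rewrite /= /term bu mulf_eq0 intr_eq0 gt_eqF //= mulf_eq0 (gt_eqF ui) orbF.
  by case: (b (fire i u)) => //; rewrite subr0 oner_eq0.
- suff -> : fire i u = u by [].
  by apply/ffunP => j; rewrite fireE ui mulr0 subr0.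
Qed.

(** * Connectedness of the diagram and positivity of [d] *)

Lemma cartan_connected (t : affine_type) (P : 'I_(nv t) -> Prop) : valid_type t ->
  (forall i : 'I_(nv t), i = 0%N :> nat -> P i) ->
  (forall i j, cartan i j != 0 -> P i -> P j) -> forall i, P i.
Proof.
move=> Ht P0 Pstep.
(* Moving to natural numbers lets vertices be named by numerals; [Q] is vacuous out of range. *)
pose Q k := forall i : 'I_(nv t), i = k :> nat -> P i.
suff QT k : (k < nv t)%N -> Q k by move=> i; apply: (QT i).
have Q0 : Q 0%N by [].
have step a b : (a < nv t)%N -> cm t a b != 0 -> Q a -> Q b.
  by move=> at_ ab Qa i ib; apply: (Pstep (Ordinal at_)); [rewrite /cartan /= ib|apply: Qa].
clearbody Q; move: Ht step k; rewrite /cm {P P0 Pstep}.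
case: t => [n|n|n|n|||||] /= n_ge step k.
- elim: k => [//|k IH] kn; apply: (step k); [lia| |apply: IH; lia].
  by rewrite /adj_chain; repeat case: ifP => //; lia.
- have Q2 : Q 2%N by apply: (step 0%N) => //; repeat case: ifP => //; lia.
  have Q1 : Q 1%N by apply: (step 2%N) => //; repeat case: ifP => //; lia.
  elim: k => [//|[//|[//|k]] IH] kn; apply: (step k.+2); [lia| |apply: IH; lia].
  by rewrite /adj_chain; repeat case: ifP => //; lia.
- elim: k => [//|k IH] kn; apply: (step k); [lia| |apply: IH; lia].
  by rewrite /adj_chain; repeat case: ifP => //; lia.
- have Q2 : Q 2%N by apply: (step 0%N) => //; repeat case: ifP => //; lia.
  have Q1 : Q 1%N by apply: (step 2%N) => //; repeat case: ifP => //; lia.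
  elim/ltn_ind: k => -[//|[//|[//|k]]] IH kn.
  (* Vertex [n] hangs off [n - 2]; each other vertex beyond 2 is adjacent to its predecessor. *)
  have [kn'|kn'] := eqVneq k.+3 n.
    apply: (step (n - 2)%N); [lia| |apply: IH; lia].
    by rewrite /adj_chain; repeat case: ifP => //; lia.
  apply: (step k.+2); [lia| |apply: IH; lia].
  by rewrite /adj_chain; repeat case: ifP => //; lia.
- have Q6 : Q 6%N by apply: (step 0%N).
  have Q3 : Q 3%N by apply: (step 6%N).
  have Q2 : Q 2%N by apply: (step 3%N).
  have Q4 : Q 4%N by apply: (step 3%N).
  have Q1 : Q 1%N by apply: (step 2%N).
  have Q5 : Q 5%N by apply: (step 4%N).
  by do 7?[case: k => [|k] //].
- have Q1 : Q 1%N by apply: (step 0%N).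
  have Q2 : Q 2%N by apply: (step 1%N).
  have Q3 : Q 3%N by apply: (step 2%N).
  have Q4 : Q 4%N by apply: (step 3%N).
  have Q5 : Q 5%N by apply: (step 4%N).
  have Q6 : Q 6%N by apply: (step 5%N).
  have Q7 : Q 7%N by apply: (step 3%N).
  by do 8?[case: k => [|k] //].
- have Q1 : Q 1%N by apply: (step 0%N).
  have Q2 : Q 2%N by apply: (step 1%N).
  have Q3 : Q 3%N by apply: (step 2%N).
  have Q4 : Q 4%N by apply: (step 3%N).
  have Q5 : Q 5%N by apply: (step 4%N).
  have Q6 : Q 6%N by apply: (step 5%N).
  have Q7 : Q 7%N by apply: (step 6%N).
  have Q8 : Q 8%N by apply: (step 5%N).
  by do 9?[case: k => [|k] //].
- have Q1 : Q 1%N by apply: (step 0%N).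
  have Q2 : Q 2%N by apply: (step 1%N).
  have Q3 : Q 3%N by apply: (step 2%N).
  have Q4 : Q 4%N by apply: (step 3%N).
  by do 5?[case: k => [|k] //].
- have Q1 : Q 1%N by apply: (step 0%N).
  have Q2 : Q 2%N by apply: (step 1%N).
  by do 3?[case: k => [|k] //].
Qed.

Lemma cartan_neq0C (t : affine_type) (i j : 'I_(nv t)) : valid_type t ->
  cartan i j != 0 -> cartan j i != 0.
Proof.
move=> Ht; apply: contra => /eqP ji.
have := cartan_symmetrizable i j Ht; rewrite ji mulr0 => /eqP.
by rewrite mulf_eq0 gt_eqF // (lt_le_trans _ (half_norm_ge1 t i)).
Qed.

Lemma delta_kernel (t : affine_type) (d : {ffun 'I_(nv t) -> int}) i :
  is_delta d -> \sum_j cartan i j * d j = 0.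
Proof.
move=> [_ [_ /(_ _ (root_simple i))]]; rewrite /cform (bigD1 i) //= [X in _ + X]big1 ?addr0.
  by move=> E; rewrite -[RHS]E; apply: eq_bigr => j _; rewrite ffunE eqxx mul1r.
by move=> k ki; apply: big1 => j _; rewrite ffunE (negbTE ki) !mul0r.
Qed.

Lemma delta0 (t : affine_type) (d : {ffun 'I_(nv t) -> int}) (i : 'I_(nv t)) :
  is_delta d -> i = 0%N :> nat -> d i = 1.
Proof. by move=> [_ [dE _]] i0; apply: dE; rewrite /extending i0; case: (t). Qed.

(** Positivity spreads along edges from vertex 0. If [d j = 0], row [j] of the kernel relation
    consists of nonpositive terms with sum zero, so no neighbour of [j] has a positive
    coefficient. *)
Lemma delta_gt0 (t : affine_type) (d : {ffun 'I_(nv t) -> int}) (i : 'I_(nv t)) :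
  valid_type t -> is_delta d -> 0 < d i.
Proof.
move=> Ht dd; have d_ge0 := dd.1; move: i.
apply: cartan_connected => // [i i0|i j ij di]; first by rewrite (delta0 dd i0).
rewrite lt_neqAle d_ge0 andbT eq_sym; apply/eqP => dj.
have ji : j != i by apply: contraTneq di => <-; rewrite dj.
have /eqP := delta_kernel j dd.
rewrite -oppr_eq0 -sumrN psumr_eq0 => [/allP/(_ i)|k _].
  rewrite mem_index_enum => /(_ isT) /=.
  by rewrite oppr_eq0 mulf_eq0 (gt_eqF di) orbF (negbTE (cartan_neq0C Ht ij)).
have [<-|jk] := eqVneq j k; first by rewrite dj mulr0 oppr0.
by rewrite oppr_ge0 mulr_le0_ge0 // cartan_le0.
Qed.

(** * The symmetrized Cartan form, its radical and its bounds *)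

Definition sform (t : affine_type) (x y : 'I_(nv t) -> int) : int :=
  \sum_(i < nv t) \sum_(j < nv t) half_norm t i * cartan i j * (x i * y j).

Lemma sformC (t : affine_type) (x y : 'I_(nv t) -> int) : valid_type t ->
  sform x y = sform y x.
Proof.
move=> Ht; rewrite /sform [LHS]exchange_big /=; apply: eq_bigr => j _; apply: eq_bigr => i _.
by rewrite cartan_symmetrizable // (mulrC (x i)).
Qed.

Lemma sform_subl (t : affine_type) (x x' y : 'I_(nv t) -> int) c :
  sform (fun k => x k - c * x' k) y = sform x y - c * sform x' y.
Proof.
rewrite /sform mulr_sumr -sumrB; apply: eq_bigr => i _.
by rewrite mulr_sumr -sumrB; apply: eq_bigr => j _; ring.
Qed.

Lemma sform_subr (t : affine_type) (x y y' : 'I_(nv t) -> int) c : valid_type t ->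
  sform x (fun k => y k - c * y' k) = sform x y - c * sform x y'.
Proof. by move=> Ht; rewrite ![sform x _]sformC // sform_subl. Qed.

Lemma sform_delta (t : affine_type) (d : {ffun 'I_(nv t) -> int}) (x : 'I_(nv t) -> int) :
  is_delta d -> sform x d = 0.
Proof.
move=> dd; rewrite /sform big1 // => i _.
transitivity (half_norm t i * x i * \sum_j cartan i j * d j).
  by rewrite mulr_sumr; apply: eq_bigr => j _; ring.
by rewrite delta_kernel // mulr0.
Qed.

(** Expanding the squares, the pure terms carry row or column sums of [G] and vanish; only the cross
    terms remain. *)
Lemma laplacian_form (F : comNzRingType) (n : nat) (G : 'I_n -> 'I_n -> F) (y : 'I_n -> F) :
  (forall i j, G i j = G j i) -> (forall i, \sum_j G i j = 0) ->
  \sum_i \sum_j G i j * (y i - y j) ^+ 2 = - 2 * \sum_i \sum_j G i j * (y i * y j).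
Proof.
move=> Gsym G0.
have row : \sum_i \sum_j G i j * y i ^+ 2 = 0.
  by apply: big1 => i _; rewrite -mulr_suml G0 mul0r.
have col : \sum_i \sum_j G i j * y j ^+ 2 = 0.
  by rewrite exchange_big -[RHS]row; do 2![apply: eq_bigr => ? _]; rewrite Gsym.
rewrite -[RHS]add0r -[X in X + _]addr0 -[X in X + _ + _]row -[X in _ + X + _]col.
rewrite mulr_sumr -!big_split /=.
apply: eq_bigr => i _; rewrite mulr_sumr -!big_split /=.
by apply: eq_bigr => j _; ring.
Qed.

(** Scaling rows and columns by [d] gives a matrix [G] with zero row sums, a weighted graph
    Laplacian. In the coordinates [y = x / d], twice [sform x x] is then a sum of nonnegative edge
    terms, of which only the one at [(i, j)] is kept. *)
Lemma sform_edge_bound (t : affine_type) (d : {ffun 'I_(nv t) -> int})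
    (x : 'I_(nv t) -> int) (i j : 'I_(nv t)) :
  valid_type t -> is_delta d -> i != j -> cartan i j != 0 ->
  (x i * d j - x j * d i) ^+ 2 <= 2 * (d i * d j) ^+ 2 * sform x x.
Proof.
move=> Ht dd ij cij.
have dpos k : 0 < d k by exact: delta_gt0.
have dneq0 k : (d k)%:~R != 0 :> rat by rewrite intr_eq0 gt_eqF.
pose G (k l : 'I_(nv t)) : rat := (half_norm t k * cartan k l * (d k * d l))%:~R.
pose y (k : 'I_(nv t)) : rat := (x k)%:~R / (d k)%:~R.
have Gsym k l : G k l = G l k.
  by rewrite /G cartan_symmetrizable // (mulrC (d k)).
have G0 k : \sum_l G k l = 0.
  rewrite /G -rmorph_sum /=.
  transitivity ((half_norm t k * d k * \sum_l cartan k l * d l)%:~R : rat).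
    by congr (_%:~R); rewrite mulr_sumr; apply: eq_bigr => l _; ring.
  by rewrite delta_kernel // mulr0.
have Gle0 k l : k != l -> G k l <= 0.
  move=> kl; rewrite lerz0 mulr_le0_ge0 ?mulr_ge0 ?(ltW (dpos _)) //.
  rewrite mulr_ge0_le0 ?cartan_le0 //; exact: le_trans (half_norm_ge1 t k).
(* Integrality enters here: a nonzero nonpositive integer is at most -1, and the other factors are
   at least 1. *)
have Gij : G i j <= -1.
  rewrite -[-1]/((-1)%:~R) ler_int.
  have := half_norm_ge1 t i; have := cartan_le0 ij; have := dpos i; have := dpos j.
  move: cij; set h := half_norm t i; set c := cartan i j => c0 dj di cle h1.
  have c1 : c <= -1 by lia.
  have dd1 : 1 <= d i * d j by nia.
  have hc : h * c <= -1 by nia.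
  nia.
have := laplacian_form y Gsym G0.
have -> : \sum_k \sum_l G k l * (y k * y l) = (sform x x)%:~R.
  rewrite /sform rmorph_sum; apply: eq_bigr => k _.
  rewrite rmorph_sum; apply: eq_bigr => l _.
  rewrite /G /y !rmorphM /=; field; by rewrite !dneq0.
have nonneg k l : 0 <= - (G k l * (y k - y l) ^+ 2).
  have [->|kl] := eqVneq k l; first by rewrite subrr expr0n mulr0 oppr0.
  by rewrite oppr_ge0 mulr_le0_ge0 ?Gle0 ?sqr_ge0.
move=> /(congr1 -%R); rewrite mulNr opprK -sumrN.
under eq_bigr do rewrite -sumrN.
rewrite (bigD1 i) //= (bigD1 j) //= => E.
have yb : (y i - y j) ^+ 2 <= 2 * (sform x x)%:~R.
  rewrite -E -addrA; apply: ler_wpDr; last by have := sqr_ge0 (y i - y j); nra.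
  by apply: addr_ge0; apply: sumr_ge0 => k _ //; apply: sumr_ge0.
rewrite -(ler_int rat).
have -> : ((x i * d j - x j * d i) ^+ 2)%:~R = (d i * d j)%:~R ^+ 2 * (y i - y j) ^+ 2.
  rewrite -exprMn rmorphXn /=; congr (_ ^+ 2).
  rewrite /y rmorphB !rmorphM /=; field; by rewrite !dneq0.
have -> : (2 * (d i * d j) ^+ 2 * sform x x)%:~R
    = (d i * d j)%:~R ^+ 2 * (2 * (sform x x)%:~R) :> rat by ring.
by rewrite ler_wpM2l ?sqr_ge0.
Qed.

(** Vanishing at vertex 0 rules out drift along the radical direction [d]; the edge bound then
    carries a bound from each vertex to its neighbours. *)
Lemma sform_bounded (t : affine_type) (d : {ffun 'I_(nv t) -> int}) (M : int) :
  valid_type t -> is_delta d ->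
  exists N : nat, forall x : 'I_(nv t) -> int,
    (forall i : 'I_(nv t), i = 0%N :> nat -> x i = 0) -> sform x x <= M ->
    forall i, `|x i| <= N%:Z.
Proof.
move=> Ht dd.
have dpos k : 0 < d k by exact: delta_gt0.
suff /choice [N NP] : forall i : 'I_(nv t), exists N : nat, forall x : 'I_(nv t) -> int,
    (forall i : 'I_(nv t), i = 0%N :> nat -> x i = 0) -> sform x x <= M -> `|x i| <= N%:Z.
  exists (\max_i N i)%N => x x0 xM i; apply: le_trans (NP i x x0 xM) _.
  by rewrite lez_nat leq_bigmax.
apply: cartan_connected => // [i i0|i j cij [N NP]].
  by exists 0%N => x /(_ _ i0) ->.
have [<-|ij] := eqVneq i j; first by exists N.
(* With [z = x i * d j - x j * d i], integrality gives [|z| <= z ^+ 2], which the edge bound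
   controls, and [d i >= 1] allows dropping the factor [d i] from [x j * d i]. *)
exists (N * `|d j| + `|(2 * (d i * d j) ^+ 2 * M)%R| + 1)%N => x x0 xM.
have := sform_edge_bound x Ht dd ij cij; have := NP x x0 xM.
have := dpos i; have := dpos j.
set K := 2 * (d i * d j) ^+ 2 => dj di xi edge.
have K0 : 0 <= K by rewrite /K mulr_ge0 ?sqr_ge0.
clearbody K.
have : (x i * d j - x j * d i) ^+ 2 <= `|K * M|.
  by apply: le_trans edge (le_trans _ (ler_norm _)); rewrite ler_wpM2l.
have [z zE] : exists z, z = x i * d j - x j * d i by exists (x i * d j - x j * d i).
rewrite -zE => zb.
have zle : `|z| <= `|K * M| by nia.
have xjd : `|x j| <= `|x i| * d j + `|z|.
  have : `|x j| * d i <= `|x i| * d j + `|z|.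
    rewrite -[d i in leLHS]gtr0_norm // -[d j]gtr0_norm // -!normrM.
    have -> : x j * d i = x i * d j - z by rewrite zE; ring.
    exact: ler_normB.
  by apply: le_trans; rewrite ler_peMr //; lia.
have : `|x i| * d j <= N%:Z * d j by rewrite ler_wpM2r // ltW.
lia.
Qed.

(** * Finiteness of the orbit *)

Lemma act_gram (R : realType) (t : affine_type) (w : seq 'I_(nv t)) : valid_type t ->
  exists X : 'I_(nv t) -> 'I_(nv t) -> int,
    (forall (v : {ffun 'I_(nv t) -> R}) j, act w v j = \sum_k (X j k)%:~R * v k) /\
    (forall j k, sform (X j) (X k) = half_norm t j * cartan j k).
Proof.
move=> Ht; elim: w => [|i w [X [Xact Xgram]]].
  exists (fun j k => (j == k)%:Z); split=> [v j|j k].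
    rewrite (bigD1 j) //= eqxx mul1r big1 ?addr0 // => k kj.
    by rewrite eq_sym (negbTE kj) mul0r.
  rewrite /sform (bigD1 j) //= (bigD1 k) //= !eqxx !mulr1 !big1 ?addr0 //.
    by move=> a aj; apply: big1 => b _; rewrite eq_sym (negbTE aj) mul0r mulr0.
  by move=> b bk; rewrite [k == b]eq_sym (negbTE bk) !mulr0.
(* The rows of [X] are roots in simple-root coordinates; each row is reflected in row [i], which
   preserves all inner products. *)
exists (fun j k => X j k - cartan i j * X i k); split=> [v j|j k].
  rewrite /= fireE !Xact mulr_sumr -sumrB; apply: eq_bigr => k _.
  by rewrite rmorphB rmorphM /=; ring.
rewrite sform_subl !sform_subr // !Xgram cartan_diag.
rewrite (cartan_symmetrizable j i Ht); ring.
Qed.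

Lemma act_finite (R : realType) (t : affine_type) (d : {ffun 'I_(nv t) -> int})
    (v : {ffun 'I_(nv t) -> R}) :
  valid_type t -> is_delta d -> dotv d v = 0 ->
  exists L : seq {ffun 'I_(nv t) -> R}, forall w, act w v \in L.
Proof.
move=> Ht dd dv.
have nv_gt0 : (0 < nv t)%N by case: (t).
pose i0 := Ordinal nv_gt0.
(* Row [j] has norm [2 * half_norm t j]; the sum bounds all rows at once. *)
pose M : int := \sum_(j < nv t) half_norm t j * 2.
have [N NP] := sform_bounded M Ht dd.
(* [conf] decodes a matrix with entries in [0..2N], shifted down by [N], so its codomain is a finite
   list. *)
pose conf (Z : {ffun 'I_(nv t) -> {ffun 'I_(nv t) -> 'I_(N + N).+1}}) : {ffun 'I_(nv t) -> R} :=
  [ffun j => \sum_k ((Z j k : nat)%:Z - N%:Z)%:~R * v k].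
exists (codom conf) => w; apply/codomP.
have [X [Xact Xgram]] := act_gram R w Ht.
(* Adding multiples of [d] to a coefficient vector changes neither its value at [v] nor its norm. *)
pose Y j k := X j k - X j i0 * d k.
have Yact j : act w v j = \sum_k (Y j k)%:~R * v k.
  transitivity (\sum_k (X j k)%:~R * v k - (X j i0)%:~R * dotv d v).
    by rewrite Xact dv mulr0 subr0.
  rewrite /dotv mulr_sumr -sumrB.
  by apply: eq_bigr => k _; rewrite rmorphB rmorphM /=; ring.
(* Since [d] is 1 at vertex 0, the rows of [Y] vanish there, as [sform_bounded] requires. *)
have Ybound j k : `|Y j k| <= N%:Z.
  apply: NP => [i /= i_0|].
    have -> : i = i0 by apply: val_inj.
    by rewrite /Y (delta0 dd) // mulr1 subrr.
  have Yl y : sform (Y j) y = sform (X j) y.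
    by rewrite [LHS]sform_subl [sform d y]sformC // sform_delta // mulr0 subr0.
  rewrite Yl sformC // Yl Xgram cartan_diag /M (bigD1 j) //= lerDl sumr_ge0 // => l _.
  by rewrite mulr_ge0 // (le_trans _ (half_norm_ge1 t l)).
exists [ffun j => [ffun k => inord `|(Y j k + N%:Z)%R|%N]].
apply/ffunP => j; rewrite ffunE Yact; apply: eq_bigr => k _.
congr (_%:~R * _); rewrite !ffunE inordK; have := Ybound j k; lia.
Qed.

(** * Legal play reaches the whole orbit *)

Theorem theorem3p1 (R : realType) (t : affine_type) (Ht : valid_type t)
  (v : {ffun 'I_(nv t) -> R})
  (Hdelta : exists d : {ffun 'I_(nv t) -> int},
      is_delta d /\ dotv d v = 0) :
  (forall g : seq 'I_(nv t), legal_reach v (act g v)) /\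
  (forall u, legal_reach v u -> legal_reach u v).
Proof.
have [d [dd dv]] := Hdelta.
have dotv_act w (u : {ffun 'I_(nv t) -> R}) : dotv d (act w u) = dotv d u.
  by elim: w => //= i w IH; rewrite dotv_fire // delta_kernel.
(* Stated for every [u] with value zero, so that it also applies at the far end of a play, for the
   way back. *)
have reach (u : {ffun 'I_(nv t) -> R}) : dotv d u = 0 -> forall w, legal_reach u (act w u).
  move=> du; have [L LP] := act_finite Ht dd du.
  (* [L] may contain configurations outside the orbit; filtering leaves exactly the orbit, without
     repetitions. *)
  pose orb := [seq x <- undup L | `[< exists w, x = act w u >]].
  have orbP x : reflect (exists w, x = act w u) (x \in orb).
    rewrite mem_filter mem_undup; apply: (iffP andP) => [[/asboolP //]|[w ->]].
    by split=> //; apply/asboolP; exists w.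
  elim=> [|i w IH]; first exact: lr_refl.
  apply/asboolP; apply: (@closed_under_fire _ _ d orb (fun x => `[< legal_reach u x >])).
  - by move=> k; apply: delta_gt0.
  - by rewrite filter_uniq // undup_uniq.
  - by move=> k x /orbP [w' ->]; apply/orbP; exists (k :: w').
  - by move=> x /orbP [w' ->]; rewrite dotv_act.
  - by move=> k x /asboolP ux xk; apply/asboolP; apply: legal_reach_rcons.
  - by apply/orbP; exists w.
  - exact/asboolP.
split; first exact: reach.
move=> u /legal_reach_act [w ->].
rewrite -[X in legal_reach _ X](act_revK w); apply: reach.
by rewrite dotv_act.
Qed.
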